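(* Let $n\ge 2$ and $\mathfrak n\ge 1$ be integers and let $\mathbf s=\{s_{i_1,\dots,i_n}\}_{i_1,\dots,i_n=0}^{2\mathfrak n-1}$ be real numbers. For $J=(j_2,\dots,j_n)\in\{0,\dots,2\mathfrak n-1\}^{n-1}$ let $\mathfrak s_J=\{\mathfrak s_{i,j_2,\dots,j_n}\}_{i=0}^{2\mathfrak n-1}$ be the associated sequence, and suppose that $\mathfrak n$ is a normal index of $\mathfrak s_J$ for every $J$. Let $n_1^{J}<\dots<n_{N_J}^{J}=\mathfrak n$ be the normal indices of $\mathfrak s_J$, and let $a_k^{J},b_k^{J}$ ($0\le k\le N_J-1$) be the atoms of $\mathfrak s_J$ and $P^{J}_{n_k}$, $Q^{J}_{n_k}$ its polynomials of the first and second kind (all defined in the context). Then any solution $F$ of the problem $\mathbf{MP}(\mathbf s,2\mathfrak n-1)$ has the representation $$F(z_1,\dots,z_n)=\sum_{j_2,\dots,j_n=0}^{2\mathfrak n-1}\frac{1}{z_2^{j_2+1}\cdots z_n^{j_n+1}}\left(-\cfrac{b_0^{J}}{a_0^{J}(z_1)-\cfrac{b_1^{J}}{a_1^{J}(z_1)-\cdots-\cfrac{b_{N_J-1}^{J}}{a_{N_J-1}^{J}(z_1)+\tau_J(z_1)}}}\right),$$ where the parameters $\tau_J$ satisfy $\tau_J(z_1)=o(1)$ as $z_1\widehat{\rightarrow}\infty$. Furthermore, this representation can be rewritten as $$F(z_1,\dots,z_n)=-\sum_{j_2,\dots,j_n=0}^{2\mathfrak n-1}\frac{1}{\prod_{i=2}^n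 z_i^{j_i+1}}\;\frac{Q^{J}_{n_{N_J-1}}(z_1)\,\tau_J(z_1)+Q^{J}_{n_{N_J}}(z_1)}{P^{J}_{n_{N_J-1}}(z_1)\,\tau_J(z_1)+P^{J}_{n_{N_J}}(z_1)} .$$
   Context: **Limits.** A Stolz domain with centre $0$ and angle $\theta\in(0,\pi/2]$ is $\{z\in\mathbb C^+:\theta<\arg z<\pi-\theta\}$; $z\widehat{\rightarrow}\infty$ means $|z|\to\infty$ inside any such Stolz domain. Identities between functions of $z_1$ are understood for $z_1$ in any such Stolz domain with $|z_1|$ sufficiently large (depending on the domain), and $z_2,\dots,z_n\neq0$. **Associated sequences.** For $J=(j_2,\dots,j_n)$, $$\mathfrak s_{i,j_2,\dots,j_n}=\binom{i+j_2+\dots+j_n}{i,j_2,\dots,j_n}s_{i,j_2,\dots,j_n}\quad(\text{multinomial coefficient}).$$ **The problem $\mathbf{MP}(\mathbf s,\ell)$.** Given real numbers $\mathbf s=\{s_{i_1,\dots,i_n}\}_{i_1,\dots,i_n=0}^{\ell}$, a solution is a function of the form $$F(z_1,\dots,z_n)=\sum_{j_2,\dots,j_n=0}^{\ell}\frac{F_{j_2,\dots,j_n}(z_1)}{z_2^{j_2+1}\cdots z_n^{j_n+1}},$$ where each $F_{J}$ is a complex function on $\mathbb C^+$ with $$F_J(z_1)=-\frac{\mathfrak s_{0,j_2,\dots,j_n}}{z_1}-\dots-\frac{\mathfrak s_{\ell,j_2,\dots,j_n}}{z_1^{\ell+1}}+o\left(\frac1{z_1^{\ell+1}}\right),\quad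 z_1\widehat{\rightarrow}\infty .$$ **Objects attached to a one-dimensional real sequence** $c=\{c_i\}_{i=0}^{2\mathfrak n-1}$ (applied to $c=\mathfrak s_J$, the superscript $J$ indicating the sequence). *Normal indices:* the integers $m$, $1\le m\le\mathfrak n$, with $D_m:=\det(c_{p+q})_{p,q=0}^{m-1}\ne0$. List them as $n_1<\dots<n_N$; assume $n_N=\mathfrak n$; put $n_0=0$ and $\nu_k=n_k-n_{k-1}$. *Atoms:* Put $c^{(0)}_i=c_i$. For $k=1,\dots,N-1$ and $0\le i\le 2\mathfrak n-2n_k-1$, $$c^{(k)}_i=\frac{(-1)^{i+\nu_k}}{\big(c^{(k-1)}_{\nu_k-1}\big)^{i+\nu_k+1}}\det(T_{pq})_{p,q=1}^{i+\nu_k+1},\qquad T_{pq}=\begin{cases}c^{(k-1)}_{\nu_k+p-q},&q\le p+1,\\0,&q>p+1.\end{cases}$$ For $k=0,\dots,N-1$, with $\nu=\nu_{k+1}$ and $D^{(k)}_\nu=\det(c^{(k)}_{p+q})_{p,q=0}^{\nu-1}$, $$b_k=c^{(k)}_{\nu-1},\qquad a_k(z)=\frac1{D^{(k)}_\nu}\begin{vmatrix}c^{(k)}_0&c^{(k)}_1&\dots&c^{(k)}_\nu\\ \vdots&\vdots&&\vdots\\ c^{(k)}_{\nu-1}&c^{(k)}_\nu&\dots&c^{(k)}_{2\nu-1}\\1&z&\dots&z^\nu\end{vmatrix}.$$ *Polynomials of the first and second kind:* $P_{n_k}$, $Q_{n_k}$ ($-1\le k\le N$) are the solutions of $$b_k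 y_{n_{k-1}}(z)-a_k(z)y_{n_k}(z)+y_{n_{k+1}}(z)=0,\quad k=0,\dots,N-1,$$ with $P_{n_{-1}}\equiv0$, $P_{n_0}\equiv1$, $Q_{n_{-1}}\equiv-1$, $Q_{n_0}\equiv0$ ($n_{-1}$ is just an index symbol). *)

(* Defs.v *)
From HB Require Import structures.
From mathcomp Require Import all_boot all_order all_algebra complex.
From mathcomp Require Import all_classical all_reals all_analysis.

Set Implicit Arguments.
Unset Strict Implicit.
Unset Printing Implicit Defensive.

Import Order.TTheory GRing.Theory Num.Theory.
Import numFieldNormedType.Exports.

Local Open Scope classical_set_scope.
Local Open Scope ring_scope.
Local Open Scope complex_scope.

Section Stolz.
Variable R : realType.

Definition upper_half_plane : set R[i] := [set z | 0 < complex.Im z].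

(* theta < arg z < pi - theta, with arg given by the polar form of z *)
Definition stolz (theta : R) : set R[i] :=
  [set z | upper_half_plane z /\ exists r phi : R,
    [/\ 0 < r, theta < phi < pi - theta &
        z = (r * cos phi) +i* (r * sin phi)]].

Definition complex_infty : set_system R[i] :=
  filter_from [set: R] (fun M => [set z | M%:C < `|z|]).

#[global] Instance complex_infty_filter : Filter complex_infty.
Proof.
apply: filter_from_filter; first by exists 0.
move=> M N _ _; exists (Num.max M N) => // z /= h.
by split; apply: le_lt_trans h; rewrite lecR le_max lexx ?orbT.
Qed.

Definition stolz_infty (theta : R) : set_system R[i] :=
  within (stolz theta) complex_infty.

#[global] Instance stolz_infty_filter theta : Filter (stolz_infty theta).
Proof. exact: within_filter. Qed.

Canonical stolz_infty_filter_on theta :=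
  FilterType (stolz_infty theta) (stolz_infty_filter theta).

(* f = o(g) as z tends to infinity inside every Stolz domain;
   the domain with angle pi / 2 is empty. *)
Definition stolz_littleo (f g : R[i] -> R[i]) : Prop :=
  forall theta : R, 0 < theta <= pi / 2 ->
    let S := stolz_infty theta in
    (f : R[i] -> R[i]^o) =o_S (g : R[i] -> R[i]^o).

Definition stolz_near (P : R[i] -> Prop) : Prop :=
  forall theta : R, 0 < theta <= pi / 2 ->
    \forall z \near stolz_infty theta, P z.

End Stolz.

(* In this section n is the number of variables and the multi-indices
   (j_2, ..., j_n), as well as the variables (z_2, ..., z_n), are indexed by
   'I_n.-1; s i J stands for s_{i, j_2, ..., j_n}. *)
Section MomentProblem.
Variables (R : realType) (n l : nat).
Implicit Types (s : 'I_l.+1 -> {ffun 'I_n.-1 -> 'I_l.+1} -> R).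
Implicit Types (J : {ffun 'I_n.-1 -> 'I_l.+1}).

Definition multinomial (i : nat) J : nat :=
  ((i + \sum_t J t)`! %/ (i`! * \prod_t (J t)`!))%N.

(* Only the values at i <= l are meaningful. *)
Definition associated_seq s J : nat -> R :=
  fun i => (multinomial i J)%:R * s (inord i) J.

Definition tail_monomial (z : 'I_n.-1 -> R[i]) J : R[i] :=
  \prod_t z t ^+ (J t).+1.

Definition MP_solution s (F : R[i] -> ('I_n.-1 -> R[i]) -> R[i]) : Prop :=
  exists FJ : {ffun 'I_n.-1 -> 'I_l.+1} -> R[i] -> R[i],
    (forall J, stolz_littleo
       (fun z => FJ J z + \sum_(i < l.+1)
                            (associated_seq s J i)%:C / z ^+ i.+1)
       (fun z => (z ^+ l.+1)^-1)) /\
    (forall z1 z, upper_half_plane z1 -> (forall t, z t != 0) ->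
       F z1 z = \sum_J FJ J z1 / tail_monomial z J).

End MomentProblem.

(* c_0, ..., c_{2 m - 1} is the sequence under study (m is the order); the
   values of c beyond that range are never used by the atoms. *)
Section Atoms.
Variable R : realType.
Implicit Types (c : nat -> R) (m k : nat).

Definition hankel_det c m : R :=
  \det (\matrix_(p < m, q < m) c (p + q)%N).

Definition normal_indices c m : seq nat :=
  [seq r <- iota 1 m | hankel_det c r != 0].

Definition n_normal c m : nat := size (normal_indices c m).

(* n_0 = 0, and n_k is the k-th normal index *)
Definition normal_index c m k : nat := nth 0%N (0%N :: normal_indices c m) k.

Definition nu c m k : nat := (normal_index c m k - normal_index c m k.-1)%N.

(* One step c^(k-1) |-> c^(k), where v is nu_k. The indices p, q start at 0. *)
Definition next_seq (v : nat) c : nat -> R := fun i =>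
  (-1) ^+ (i + v) / c v.-1 ^+ (i + v).+1 *
  \det (\matrix_(p < (i + v).+1, q < (i + v).+1)
          if (q <= p.+1)%N then c (v + p - q)%N else 0).

Fixpoint iter_seq c m k : nat -> R :=
  if k is k'.+1 then next_seq (nu c m k'.+1) (iter_seq c m k') else c.

Definition atom_b c m k : R := iter_seq c m k (nu c m k.+1).-1.

Definition atom_a c m k : {poly R} :=
  let v := nu c m k.+1 in
  (hankel_det (iter_seq c m k) v)^-1 *:
  \det (\matrix_(p < v.+1, q < v.+1)
          if (p < v)%N then (iter_seq c m k (p + q)%N)%:P else 'X^q).

(* The pair (y_{n_{k-1}}, y_{n_k}) of the solution of
   b_k y_{n_{k-1}} - a_k y_{n_k} + y_{n_{k+1}} = 0
   with y_{n_{-1}} = y.1 and y_{n_0} = y.2. *)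
Fixpoint three_term c m (y : {poly R} * {poly R}) k : {poly R} * {poly R} :=
  if k is k'.+1 then
    let: (u, v) := three_term c m y k' in
    (v, atom_a c m k' * v - atom_b c m k' *: u)
  else y.

(* first_kind c m k is P_{n_k} and second_kind c m k is Q_{n_k}, k >= 0 *)
Definition first_kind c m k : {poly R} := (three_term c m (0, 1) k).2.
Definition second_kind c m k : {poly R} := (three_term c m (-1, 0) k).2.

End Atoms.

Section ContinuedFraction.
Variable C : fieldType.

(* - b_k / (a_k - b_{k+1} / (a_{k+1} - ... - b_{k+N-1} / (a_{k+N-1} + t))) *)
Fixpoint cfrac (a b : nat -> C) (t : C) (k N : nat) : C :=
  if N is N'.+1 then - (b k / (a k + cfrac a b t k.+1 N')) else t.

(* No denominator of cfrac a b t k N vanishes. *)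
Fixpoint cfrac_defined (a b : nat -> C) (t : C) (k N : nat) : Prop :=
  if N is N'.+1 then
    a k + cfrac a b t k.+1 N' != 0 /\ cfrac_defined a b t k.+1 N'
  else True.

End ContinuedFraction.

(* Evaluation of a real polynomial at a complex point *)
Definition cval (R : realType) (p : {poly R}) (z : R[i]) : R[i] :=
  (map_poly (real_complex R) p).[z].

Section AtomsFraction.
Variables (R : realType) (c : nat -> R) (m : nat) (z t : R[i]).

Let a k := cval (atom_a c m k) z.
Let b k : R[i] := (atom_b c m k)%:C.

(* - b_0 / (a_0 z - b_1 / (a_1 z - ... - b_{N-1} / (a_{N-1} z + t))) *)
Definition atoms_cfrac : R[i] := cfrac a b t 0 (n_normal c m).

Definition atoms_cfrac_defined : Prop :=
  cfrac_defined a b t 0 (n_normal c m).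

(* With N the number of normal indices of c:
   Q_{n_{N-1}} t + Q_{n_N}  and  P_{n_{N-1}} t + P_{n_N}, evaluated at z. *)
Definition lft_num : R[i] :=
  cval (second_kind c m (n_normal c m).-1) z * t
    + cval (second_kind c m (n_normal c m)) z.

Definition lft_den : R[i] :=
  cval (first_kind c m (n_normal c m).-1) z * t
    + cval (first_kind c m (n_normal c m)) z.

End AtomsFraction.

(* Main.v *)
Require Import Defs.
From HB Require Import structures.
From mathcomp Require Import all_boot all_order all_algebra complex.
From mathcomp Require Import all_classical all_reals all_analysis.
From mathcomp Require Import ring zify.

Set Implicit Arguments.
Unset Strict Implicit.
Unset Printing Implicit Defensive.

Import Order.TTheory GRing.Theory Num.Theory.
Import numFieldNormedType.Exports.
Local Open Scope classical_set_scope.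
Local Open Scope ring_scope.
Local Open Scope complex_scope.

(** The representation is one Schur-type step, repeated. Let
    [- sum_i c_i / z^(i+1)] be the asymptotic expansion of a component [f] of
    the solution, let [v] be the first normal index of [c], and put [x = 1/z].
    The Hankel determinants of order less than [v] vanish exactly when
    [c_0 = ... = c_(v-2) = 0], so [f ~ - b x^v] with [b = c_(v-1) != 0]
    ([first_normal_index]), and [f = - x^v g(x)] for a power series [g] with
    constant term [b]. Let [h = 1/g]. Then [- b / f] is asymptotic to
    [b x^(-v) h(x)], whose polynomial part in [z] is the atom [a_0]
    ([atom_a0E]) and whose remaining coefficients are minus those of the next
    sequence [c^(1)] ([next_seq_recip]), because the Toeplitz determinants
    defining [c^(1)] are Cramer's formula for the coefficients of [1/g]
    ([recip_unique]). Hence [f = - b / (a_0 + f_1)], where [f_1] has the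
    expansion [- sum_i c^(1)_i / z^(i+1)], known up to an order lower by [2 v]
    ([expansion_next]).

    To iterate, the normal indices of [c^(1)] have to be those of [c]
    following [v], shifted by [v] ([normal_indices_cons]). This holds since
    [L H L^T], for the Hankel matrix [H] of [c] of size [v + r] and the lower
    triangular Toeplitz matrix [L] of [h], is block triangular, with diagonal
    blocks a matrix independent of [r] and [1/b] times the Hankel matrix of
    [c^(1)] of size [r] ([hankel_det_next]). As [m] is normal, the iteration
    ends with an expansion of order [0], which says that the last function,
    [tau], is [o(1)] ([atoms_cfrac_parameter]). The denominators
    [a_k + f_(k+1) = - b_k / f_k] do not vanish near infinity. The second
    formula is the usual passage from a continued fraction to a linear
    fractional transformation ([cfrac_lft]). *)

(** * Reciprocal of a power series *)

Section ReciprocalSeries.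
Variable K : fieldType.
Implicit Types (g h : nat -> K).

(** The [n]-th coefficient of the reciprocal of the power series
    [sum_j g_j x^j], in the closed form of a Toeplitz-Hessenberg determinant.
    This is meaningful when [g 0] is not [0]. *)
Definition recip g (n : nat) : K :=
  (-1) ^+ n / g 0%N ^+ n.+1 *
  \det (\matrix_(p < n, q < n) if (q <= p.+1)%N then g (p.+1 - q)%N else 0).

Lemma recip_exists g n : g 0%N != 0 ->
  exists h, forall q, (q < n)%N ->
    \sum_(j < q.+1) g j * h (q - j)%N = (q == 0%N)%:R.
Proof.
move=> g0; elim: n => [|n [h hP]]; first by exists (fun=> 0).
pose y := ((n == 0%N)%:R - \sum_(j < n) g j.+1 * h (n - j.+1)%N) / g 0%N.
exists (fun i => if i == n then y else h i) => q.
rewrite ltnS leq_eqVlt => /orP[/eqP ->|qn].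
  rewrite big_ord_recl subn0 eqxx mulrC divfK//.
  rewrite [X in _ - _ + X](eq_bigr (fun j : 'I_n => g j.+1 * h (n - j.+1)%N)).
    by rewrite subrK.
  by move=> j _; rewrite lift0 ifN//; have := ltn_ord j; lia.
rewrite -hP//; apply: eq_bigr => j _.
by rewrite ifN//; have := ltn_ord j; lia.
Qed.

(** Any sequence [h] inverse to [g] up to order [n] has [recip g n] as its
    [n]-th coefficient: this is Cramer's rule for the lower triangular Toeplitz
    matrix of [g], whose cofactor at [(0, n)] is, up to sign, the determinant in
    [recip]. *)
Lemma recip_unique g h n : g 0%N != 0 ->
  (forall q, (q <= n)%N ->
    \sum_(j < q.+1) g j * h (q - j)%N = (q == 0%N)%:R) ->
  h n = recip g n.
Proof.
move=> g0 hP.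
pose G := \matrix_(p < n.+1, q < n.+1) if (q <= p)%N then g (p - q)%N else 0.
pose H := \col_(q < n.+1) h q.
have detG : \det G = g 0%N ^+ n.+1.
  rewrite det_trig; last first.
    by apply/is_trig_mxP => i j ij; rewrite mxE leqNgt ij.
  rewrite (eq_bigr (fun=> g 0%N)) ?prodr_const ?card_ord// => i _.
  by rewrite mxE leqnn subnn.
have GH : G *m H = delta_mx ord0 ord0.
  apply/matrixP => p q; rewrite !mxE ord1 eqxx andbT.
  transitivity (\sum_(j < p.+1) g j * h (p - j)%N); last first.
    by rewrite hP // -ltnS.
  rewrite [RHS](reindex_inj rev_ord_inj)/=.
  rewrite (big_ord_widen_cond n.+1 xpredT
    (fun i => g (p.+1 - i.+1)%N * h (p - (p.+1 - i.+1))%N)) ?ltn_ord//.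
  rewrite [RHS]big_mkcond/=; apply: eq_bigr => i _; rewrite !mxE ltnS.
  case: leqP => ip; last by rewrite mul0r.
  by congr (g _ * h _); lia.
have /matrixP/(_ ord_max ord0) : \adj G *m (G *m H) = \det G *: H.
  by rewrite mulmxA mul_adj_mx mul_scalar_mx.
rewrite GH !mxE (bigD1 ord0)//= !mxE eqxx mulr1 big1 ?addr0; last first.
  by move=> i i0; rewrite !mxE (negbTE i0) mulr0.
rewrite detG /cofactor /= add0n => eqh.
apply: (mulfI (expf_neq0 n.+1 g0)).
rewrite -eqh /recip [RHS]mulrA [X in _ = X * _]mulrCA divff ?expf_neq0// mulr1.
congr (_ * \det _).
apply/matrixP => p q; rewrite !mxE lift0 lift_max /bump /=.
by case: leqP.
Qed.

Lemma recip_conv g q : g 0%N != 0 ->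
  \sum_(j < q.+1) g j * recip g (q - j)%N = (q == 0%N)%:R.
Proof.
move=> g0; have [h hP] := recip_exists q.+1 g0.
rewrite -hP//; apply: eq_bigr => j _; congr (_ * _); apply/esym.
by apply: recip_unique => // r rq; apply: hP; lia.
Qed.

Lemma recip0 g : recip g 0 = (g 0%N)^-1.
Proof. by rewrite /recip det_mx00 mulr1 expr0 expr1 mul1r. Qed.

End ReciprocalSeries.

(** * Hankel determinants of the next sequence *)

Section HankelReduction.
Variables (R : realType) (c : nat -> R) (u : nat).
Hypotheses (c_lt0 : forall i, (i < u)%N -> c i = 0) (cu_neq0 : c u != 0).

(* The first nonzero term of c is c u, so the normal index is u.+1, and h
   inverts the power series sum_j c_(u + j) x^j. *)
Let h := recip (fun j => c (u + j)%N).

Lemma next_seq_recip i : next_seq u.+1 c i = - c u * h (u.+1 + i).+1.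
Proof.
rewrite /next_seq /h /recip addn0 /= addnC.
have -> : \matrix_(p < (u.+1 + i).+1, q < (u.+1 + i).+1)
    (if (q <= p.+1)%N then c (u.+1 + p - q)%N else 0) =
  \matrix_(p, q) if (q <= p.+1)%N then c (u + (p.+1 - q))%N else 0.
  apply/matrixP => p q; rewrite !mxE; case: leqP => // qp.
  by congr (c _); lia.
move: (u.+1 + i)%N (\det _) => k D.
rewrite [(-1) ^+ k.+1]exprS [c u ^+ k.+2]exprS.
have : c u ^+ k.+1 != 0 by rewrite expf_neq0.
by move: (c u ^+ k.+1) ((-1) ^+ k) => x y x0; field; rewrite x0.
Qed.

Lemma conv_recip0 q : \sum_(j < q.+1) c j * h (q - j)%N = (q == u)%:R.
Proof.
have [qu|uq] := ltnP q u.
  rewrite big1 ?ltn_eqF// => j _; rewrite c_lt0 ?mul0r//.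
  by have := ltn_ord j; lia.
rewrite -(subnKC uq); move: (q - u)%N => r; rewrite -addnS big_split_ord/= big1.
  have -> : (u + r == u)%N = (r == 0)%N by lia.
  rewrite add0r -(recip_conv (g := fun j => c (u + j)%N)).
    by apply: eq_bigr => j _; rewrite subnDl.
  by rewrite addn0.
by move=> j _; rewrite c_lt0 ?mul0r.
Qed.

Lemma conv_recipS i q : \sum_(j < q.+2) c (i + j)%N * h (q.+1 - j)%N =
  c i * h q.+1 + \sum_(j < q.+1) c (i.+1 + j)%N * h (q - j)%N.
Proof.
rewrite big_ord_recl addn0 subn0; congr (_ + _); apply: eq_bigr => j _.
by rewrite lift0 addnS subSS.
Qed.

(** The first [u.+1] rows of the product of the Hankel matrix of [c] by the
    transposed Toeplitz matrix of [h]: as [c_i] vanishes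
    for [i < u], one may move the row index into the order of the
    convolution. *)
Lemma conv_recip i q : (i <= u)%N ->
  \sum_(j < q.+1) c (i + j)%N * h (q - j)%N = (i + q == u)%N%:R.
Proof.
elim: i q => [|i IHi] q iu; first exact: conv_recip0.
by rewrite addSnnS -IHi ?(ltnW iu)// conv_recipS c_lt0// mul0r add0r.
Qed.

(* E is the matrix L H L^T, for H the Hankel matrix of c and L the lower
   triangular Toeplitz matrix of h. The Hankel structure of H makes E almost
   constant along antidiagonals (E_shift), which determines its rows of index
   greater than u. *)
Let E p q := \sum_(i < p.+1) h (p - i)%N * \sum_(j < q.+1) c (i + j)%N * h (q - j)%N.

Let E_shift p q :
  E p q.+1 = E p.+1 q + h q.+1 * (p == u)%:R - h p.+1 * (q == u)%:R.
Proof.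
rewrite /E [X in _ = X + _ - _]big_ord_recl subn0 conv_recip//.
under eq_bigr do rewrite conv_recipS mulrDr.
rewrite big_split/= -(conv_recip0 p) mulr_sumr.
rewrite addrC [RHS]addrC !addrA addNr add0r.
by congr (_ + _); apply: eq_bigr => i _; ring.
Qed.

Let E_lower p q : (u < p)%N -> (q <= u)%N -> E p q = 0.
Proof.
elim: q p => [|q IHq] p up qu.
  rewrite /E; under eq_bigr do rewrite big_ord1 addn0 subn0 mulrA.
  rewrite -mulr_suml; under eq_bigr do rewrite mulrC.
  by rewrite conv_recip0 gtn_eqF// mul0r.
rewrite E_shift IHq ?(ltnW qu)// ?(ltnW up)//; last exact: leqW.
by rewrite gtn_eqF// ltn_eqF// !mulr0 addr0 subr0.
Qed.

Let E_diag p q : (u < p)%N -> E p (u.+1 + q)%N = - h (p + q).+1.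
Proof.
elim: q p => [|q IHq] p up.
  by rewrite !addn0 E_shift E_lower ?(leqW up)// gtn_eqF// eqxx mulr0 mulr1 !add0r.
rewrite addnS E_shift !IHq ?(leqW up)// [p == u]gtn_eqF// [_ == u]gtn_eqF; last by lia.
by rewrite !mulr0 addr0 subr0 addnS addSn.
Qed.

Let det_E n : \det (\matrix_(p < n, q < n) E p q) =
  h 0%N ^+ n * hankel_det c n * h 0%N ^+ n.
Proof.
pose L := \matrix_(p < n, i < n) if (i <= p)%N then h (p - i)%N else 0.
have detL : \det L = h 0%N ^+ n.
  rewrite det_trig; last first.
    by apply/is_trig_mxP => i j ij; rewrite mxE leqNgt ij.
  rewrite (eq_bigr (fun=> h 0%N)) ?prodr_const ?card_ord// => i _.
  by rewrite mxE leqnn subnn.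
rewrite -{2}detL -(det_tr L) -detL /hankel_det -!det_mulmx; congr (\det _).
have widen (p : 'I_n) (f g : nat -> R) :
    \sum_(i < p.+1) f (p - i)%N * g i =
    \sum_(i < n) (if (i <= p)%N then f (p - i)%N else 0) * g i.
  rewrite (big_ord_widen_cond n xpredT (fun i => f (p - i)%N * g i)) ?ltn_ord//.
  rewrite big_mkcond/=; apply: eq_bigr => i _; rewrite ltnS.
  by case: leqP => //; rewrite mul0r.
rewrite -mulmxA; apply/matrixP => p q; rewrite !mxE /E.
have /= -> := widen p h (fun i => \sum_(j < q.+1) c (i + j)%N * h (q - j)%N).
apply: eq_bigr => i _; rewrite !mxE; congr (_ * _).
under eq_bigr do rewrite mulrC.
have /= -> := widen q h (fun j => c (i + j)%N).
by apply: eq_bigr => j _; rewrite !mxE mulrC.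
Qed.

Lemma hankel_det_next r : hankel_det c u.+1 != 0 ->
  (hankel_det c (u.+1 + r) != 0) = (hankel_det (next_seq u.+1 c) r != 0).
Proof.
have h0 : h 0%N != 0 by rewrite /h recip0 addn0 invr_eq0.
have detE n : (hankel_det c n != 0) = (\det (\matrix_(p < n, q < n) E p q) != 0).
  by rewrite det_E !mulf_eq0 expf_eq0 (negbTE h0) andbF orbF.
rewrite !detE => D_neq0.
have -> : \matrix_(p < u.+1 + r, q < u.+1 + r) E p q =
   block_mx (\matrix_(p < u.+1, q < u.+1) E p q)
            (\matrix_(p < u.+1, q < r) E p (u.+1 + q)%N) 0
            ((c u)^-1 *: \matrix_(p < r, q < r) next_seq u.+1 c (p + q)%N).
  apply/matrixP => p q; rewrite mxE.
  case: (split_ordP p) => {}p ->; case: (split_ordP q) => {}q ->;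
    rewrite /= ?(block_mxEul, block_mxEur, block_mxEdl, block_mxEdr) !mxE//.
    by rewrite E_lower// ?leq_addr// -ltnS.
  rewrite E_diag ?leq_addr// next_seq_recip -addnA.
  by rewrite mulNr mulrN mulKf.
rewrite det_ublock mulf_eq0 (negbTE D_neq0)/= detZ mulf_eq0 expf_eq0 invr_eq0.
by rewrite (negbTE cu_neq0) andbF.
Qed.

End HankelReduction.

(** * Normal indices and atoms of the next sequence *)

Section FirstNormalIndex.
Variable R : realType.
Implicit Types (c : nat -> R) (u m : nat).

Lemma hankel_det_antitriangular c u :
  (forall i, (i < u)%N -> c i = 0) -> c u != 0 -> hankel_det c u.+1 != 0.
Proof.
move=> c0 cu; rewrite /hankel_det; set A := \matrix_(p < u.+1, q < u.+1) _.
pose s := perm.perm (@rev_ord_inj u.+1).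
suff : \det (col_perm s A) != 0.
  by rewrite col_permE det_mulmx mulf_eq0 negb_or => /andP[].
(* Reversing the order of the columns makes the matrix triangular. *)
rewrite det_trig; last first.
  apply/is_trig_mxP => i j ij; rewrite !mxE perm.permE/= c0//.
  by have := ltn_ord j; lia.
rewrite prodf_seq_neq0; apply/allP => i _.
by rewrite !mxE perm.permE/= subSS subnKC// -ltnS.
Qed.

Lemma first_normal_index c u :
  (forall r, (0 < r <= u)%N -> hankel_det c r = 0) -> hankel_det c u.+1 != 0 ->
  (forall i, (i < u)%N -> c i = 0) /\ c u != 0.
Proof.
move=> D0 Du.
have c0 i : (i < u)%N -> c i = 0.
  elim/ltn_ind: i => i IHi iu; apply/eqP; apply: contraT => ci.
  have := hankel_det_antitriangular (fun j ji => IHi j ji (ltn_trans ji iu)) ci.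
  by rewrite D0 ?eqxx.
split=> //; apply: contraNneq Du => cu.
rewrite /hankel_det (expand_det_row _ ord0) big1 // => j _.
rewrite mxE add0n; have := ltn_ord j; rewrite ltnS leq_eqVlt.
by case/orP => [/eqP ->|/c0 ->]; rewrite ?cu mul0r.
Qed.

(** The first normal index [u.+1] of [c], and the other ones in terms of the
    normal indices of the next sequence. For [m = u.+1] the next sequence
    is considered up to order [0], with empty determinant [1]. *)
Lemma normal_indices_cons c m : (0 < m)%N -> hankel_det c m != 0 ->
  exists u, [/\ (u < m)%N, forall i, (i < u)%N -> c i = 0, c u != 0,
    hankel_det (next_seq u.+1 c) (m - u.+1) != 0 &
    normal_indices c m =
      u.+1 :: map (addn u.+1) (normal_indices (next_seq u.+1 c) (m - u.+1))].
Proof.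
move=> m0 Dm.
have exD : exists r, (0 < r)%N && (hankel_det c r != 0) by exists m; rewrite m0.
case: (ex_minnP exD) => -[//|u] /= Du minu.
have um : (u < m)%N by apply: minu; rewrite m0.
have D0 r : (0 < r <= u)%N -> hankel_det c r = 0.
  case/andP=> r0 ru; apply/eqP; apply: contraT => Dr.
  by have := minu r; rewrite r0 Dr => /(_ isT); rewrite leqNgt ltnS ru.
have [c0 cu] := first_normal_index D0 Du.
exists u; split=> //.
  by rewrite -hankel_det_next// subnKC.
rewrite /normal_indices -[in LHS](subnKC um) addSnnS iotaD filter_cat.
rewrite (_ : [seq _ <- iota 1 u | _] = [::]); last first.
  rewrite -(filter_pred0 (iota 1 u)); apply: eq_in_filter => r.
  by rewrite mem_iota add1n ltnS => /D0 ->; rewrite eqxx.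
rewrite cat0s/= add1n Du; congr (_ :: _).
rewrite -addn1 iotaDl filter_map; congr map; apply: eq_filter => r /=.
by rewrite hankel_det_next.
Qed.

(** The atom [a_0] is the polynomial part in [z] of the quotient of [c_u] by
    [sum_i c_i / z^(i+1)]. *)
Lemma atom_a0E c m u : nu c m 1 = u.+1 ->
  (forall i, (i < u)%N -> c i = 0) -> c u != 0 ->
  atom_a c m 0 = c u *:
    \sum_(j < u.+2) recip (fun j => c (u + j)%N) j *: 'X^(u.+1 - j).
Proof.
move=> nuE c0 cu; rewrite /atom_a nuE /=.
set h := recip _.
have D0 : hankel_det c u.+1 != 0 by exact: hankel_det_antitriangular.
set M := \matrix_(p < u.+2, q < u.+2) _; set A := _ *: \sum_(j < u.+2) _.
(* M maps the vector w of coefficients of A to A times the last unit vector,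
   so that Cramer's rule for the leading coefficient 1 of A gives
   \det M = A * cofactor M ord_max ord_max. *)
pose w : 'cV[{poly R}]_u.+2 := \col_q (c u * h (u.+1 - q)%N)%:P.
have Mw : M *m w = A *: delta_mx ord_max ord0.
  apply/matrixP => p q; rewrite ord1 !mxE eqxx andbT.
  have [pu|pu] := ltnP p u.+1.
    have -> : (p == ord_max) = false by apply/negbTE; rewrite neq_ltn/= pu.
    rewrite mulr0 (eq_bigr (fun j : 'I_u.+2 =>
      (c u * (c (p + j)%N * h (u.+1 - j)%N))%:P)); last first.
      by move=> j _; rewrite !mxE pu -polyCM; congr _%:P; ring.
    rewrite -rmorph_sum -mulr_sumr conv_recip// (_ : (_ == u)%N = false) ?mulr0//.
    by lia.
  have -> : p = ord_max by apply/val_inj/eqP; rewrite eqn_leq -ltnS ltn_ord.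
  rewrite eqxx mulr1 /A scaler_sumr [RHS](reindex_inj rev_ord_inj)/=.
  apply: eq_bigr => j _; rewrite !mxE ltnn subSS mulrC mul_polyC scalerA.
  by rewrite subKn// -ltnS.
have /matrixP/(_ ord_max ord0) : \adj M *m (M *m w) = \det M *: w.
  by rewrite mulmxA mul_adj_mx mul_scalar_mx.
rewrite Mw -scalemxAr !mxE (bigD1 ord_max)//= !mxE !eqxx mulr1 big1 ?addr0; last first.
  by move=> i /negbTE i0; rewrite !mxE i0 mulr0.
rewrite subnn /h recip0 addn0 divff// mulr1 => <-.
rewrite /cofactor/= addnn -mul2n exprM sqrrN !expr1n mul1r.
have -> : row' ord_max (col' ord_max M) =
    map_mx polyC (\matrix_(p < u.+1, q < u.+1) c (p + q)%N).
  by apply/matrixP => p q; rewrite !mxE !lift_max ltn_ord.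
rewrite det_map_mx -/(hankel_det c u.+1) -mul_polyC mulrC -mulrA -polyCM.
by rewrite divff// mulr1.
Qed.

End FirstNormalIndex.

(* Here c' is c^(1), taken up to the order m', and the atoms of c' are those of c
   with the index lowered by one. *)
Section Shift.
Variables (R : realType) (c c' : nat -> R) (m m' u : nat).
Hypothesis c'E : c' = next_seq u.+1 c.
Hypothesis niE :
  normal_indices c m = u.+1 :: map (addn u.+1) (normal_indices c' m').

Lemma nu_first : nu c m 1 = u.+1.
Proof. by rewrite /nu /normal_index/= niE/= subn0. Qed.

Lemma n_normal_shift : n_normal c m = (n_normal c' m').+1.
Proof. by rewrite /n_normal niE/= size_map. Qed.

Lemma nu_shift k : nu c m k.+2 = nu c' m' k.+1.
Proof.
rewrite /nu /normal_index/= niE/=.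
have [kn|nk] := ltnP k (size (normal_indices c' m')); last first.
  rewrite [nth _ (normal_indices c' m') k]nth_default//.
  by rewrite [nth _ (map _ _) k]nth_default ?size_map.
rewrite (nth_map 0%N)//; case: k kn => [|k] kn /=; first by rewrite addnC addnK subn0.
by rewrite (nth_map 0%N) ?subnDl// ltnW.
Qed.

Lemma iter_seq_shift k : iter_seq c m k.+1 = iter_seq c' m' k.
Proof.
elim: k => [|k IHk]; first by rewrite /= nu_first c'E.
by rewrite [LHS]/= -/(iter_seq c m k.+1) IHk nu_shift.
Qed.

Lemma atom_b_shift k : atom_b c m k.+1 = atom_b c' m' k.
Proof. by rewrite /atom_b iter_seq_shift nu_shift. Qed.

Lemma atom_a_shift k : atom_a c m k.+1 = atom_a c' m' k.
Proof. by rewrite /atom_a nu_shift iter_seq_shift. Qed.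

End Shift.

(** * One step of the expansion at infinity *)

Section Asymptotics.
Variables (R : realType) (K : numFieldType) (phi : {rmorphism R -> K}).

(** [f] tends to [0] along [F]. *)
Definition vanishes (T : Type) (F : set_system T) (f : T -> K) : Prop :=
  f @ F --> (0 : K).

Lemma eqo_vanishes (T : Type) (F : filter_on T) (f g : T -> K) :
  (\forall x \near F, g x != 0) ->
  ((f : T -> K^o) =o_F (g : T -> K^o)) <-> vanishes F (fun x => f x / g x).
Proof.
move=> g0; rewrite /vanishes; split.
  move=> /eqoP fo; apply/cvgr0Pnorm_le => e e0.
  apply: filterS2 g0 (fo e e0) => x gx.
  by rewrite normrM normfV ler_pdivrMr// normr_gt0.
move=> /cvgr0Pnorm_le fg; apply/eqoP => e e0.
apply: filterS2 g0 (fg e e0) => x gx.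
by rewrite normrM normfV ler_pdivrMr// normr_gt0.
Qed.

Lemma horner_map_poly n (E : nat -> R) x :
  (map_poly phi (\poly_(j < n) E j)).[x] = \sum_(j < n) phi (E j) * x ^+ j.
Proof.
rewrite poly_def rmorph_sum horner_sum; apply: eq_bigr => j _.
by rewrite /= map_polyZ map_polyXn hornerZ hornerXn.
Qed.

(** [f z = - sum_(i < N) c_i / z^(i+1) + o(1 / z^N)] along [F]; the real numbers
    [c_i] are carried to [K] by [phi]. For [N = 0] this says that [f] vanishes
    along [F]. *)
Definition moment_expansion (F : set_system K) (c : nat -> R) (N : nat) (f : K -> K) :=
  vanishes F (fun z => (f z + \sum_(i < N) phi (c i) / z ^+ i.+1) * z ^+ N).

Variable F : set_system K.
Context {FF : Filter F}.
Hypothesis F_neq0 : \forall z \near F, z != 0.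
Hypothesis F_inv : vanishes F (fun z => z^-1).

Lemma cvg_horner_inv (p : {poly K}) : p.[z^-1] @[z --> F] --> p.[0].
Proof.
elim/poly_ind: p => [|p a IHp].
  by rewrite horner0; under eq_fun do rewrite horner0; exact: cvg_cst.
rewrite hornerMXaddC; under eq_fun do rewrite hornerMXaddC.
by apply: cvgD; [exact: cvgM|exact: cvg_cst].
Qed.

Section Step.
Variables (c : nat -> R) (u N : nat) (f : K -> K).
Hypotheses (c_lt0 : forall i, (i < u)%N -> c i = 0) (cu_neq0 : c u != 0).
Hypothesis uN : (2 * u.+1 <= N)%N.
Hypothesis f_exp : moment_expansion F c N f.

Let h := recip (fun j => c (u + j)%N).
Let L := (N - u.+1)%N.
(* G H = 1 + x^(L+1) W for the truncations G and H of the power series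
   sum_j c_(u + j) x^j and of its reciprocal. *)
Let G := \poly_(j < L.+1) c (u + j)%N.
Let H := \poly_(j < L.+1) h j.
Let W := drop_poly L.+1 (G * H).

Let GH1 : G * H = 1 + W * 'X^(L.+1).
Proof.
rewrite -[LHS](poly_take_drop L.+1) -/W; congr (_ + _).
apply/polyP => i; rewrite coef_take_poly coef1; case: ltnP => iL; last first.
  by rewrite gtn_eqF// (leq_trans _ iL).
rewrite coefM -(recip_conv (g := fun j => c (u + j)%N)) ?addn0//.
apply: eq_bigr => j _; rewrite !coef_poly !ifT//.
  by rewrite ltnS leq_subLR; lia.
by have := ltn_ord j; lia.
Qed.

Let momentsE z : z != 0 -> \sum_(i < N) phi (c i) / z ^+ i.+1 =
  (map_poly phi G).[z^-1] / z ^+ u.+1.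
Proof.
move=> z0; have -> : N = (u + L.+1)%N by rewrite /L; lia.
rewrite big_split_ord/= big1 ?add0r; last first.
  by move=> i _; rewrite c_lt0// rmorph0 mul0r.
rewrite horner_map_poly mulr_suml; apply: eq_bigr => j _.
by rewrite -addSn exprD invfM exprVn mulrA mulrAC.
Qed.

Let tailE z : z != 0 ->
  phi (c u) * \sum_(j < u.+2) phi (h j) * z ^+ (u.+1 - j) -
    \sum_(i < N - 2 * u.+1) phi (next_seq u.+1 c i) / z ^+ i.+1 =
  phi (c u) * (z ^+ u.+1 * (map_poly phi H).[z^-1]).
Proof.
move=> z0; rewrite horner_map_poly.
have -> : L.+1 = (u.+2 + (N - 2 * u.+1))%N by rewrite /L; lia.
rewrite big_split_ord/= [in RHS]mulrDr [in RHS]mulrDr; congr (_ + _).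
  rewrite !mulr_sumr; apply: eq_bigr => j _.
  rewrite expfB_cond; last by rewrite (negbTE z0) add0n -ltnS.
  by rewrite exprVn; ring.
rewrite !mulr_sumr -sumrN; apply: eq_bigr => i _.
rewrite next_seq_recip// -/h rmorphM rmorphN -addnS -(addSnnS u.+1) addSnnS.
rewrite exprVn exprD; field.
by rewrite !expf_neq0.
Qed.

(** The leading term of the expansion: [f ~ - c_u / z^(u+1)]. *)
Lemma expansion_lead : f z * z ^+ u.+1 @[z --> F] --> - phi (c u).
Proof.
pose e z := (f z + \sum_(i < N) phi (c i) / z ^+ i.+1) * z ^+ N.
apply: cvg_trans (_ : e z * ('X^L).[z^-1] - (map_poly phi G).[z^-1] @[z --> F]
   --> - phi (c u)).
  apply: near_eq_cvg; apply: filterS F_neq0 => z z0.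
  rewrite /e momentsE// hornerXn exprVn.
  have -> : z ^+ N = z ^+ L * z ^+ u.+1 by rewrite -exprD /L subnK//; lia.
  by field; rewrite !expf_neq0.
rewrite -[- phi _]add0r -(mul0r ('X^L).[0]).
apply: cvgB; first by apply: cvgM => //; exact: cvg_horner_inv.
have -> : phi (c u) = (map_poly phi G).[0].
  by rewrite horner_coef0 coef_map coef_poly/= addn0.
exact: cvg_horner_inv.
Qed.

Lemma expansion_neq0 : \forall z \near F, f z != 0.
Proof.
have : - phi (c u) != 0 by rewrite oppr_eq0 fmorph_eq0.
move=> /(cvgr_neq0 _ expansion_lead); apply: filterS => z.
by rewrite mulf_eq0 negb_or => /andP[].
Qed.

(** If [f] has the expansion of [c], then [- c_u / f] minus the polynomial part
    of its expansion has the expansion of the next sequence.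
    The remainder of [f], of relative size [o(z^(u+1) / z^N)], is multiplied by
    [- c_u / f], of size [z^(u+1)]; whence the order [N - 2 * u.+1]. *)
Lemma expansion_next : moment_expansion F (next_seq u.+1 c) (N - 2 * u.+1)
  (fun z => - (phi (c u) / f z) -
     phi (c u) * \sum_(j < u.+2) phi (h j) * z ^+ (u.+1 - j)).
Proof.
(* With x = z^-1, the function in the statement is
   - c_u / (f z^(u+1)) * (e H(x) - x W(x)), whose second factor tends to 0. *)
pose e z := (f z + \sum_(i < N) phi (c i) / z ^+ i.+1) * z ^+ N.
rewrite /moment_expansion /vanishes.
apply: cvg_trans (_ : - (phi (c u) / (f z * z ^+ u.+1)) *
   (e z * (map_poly phi H).[z^-1] - (map_poly phi (W * 'X)).[z^-1])
   @[z --> F] --> (0 : K)).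
  apply: near_eq_cvg; apply: filterS2 F_neq0 expansion_neq0 => z z0 fz.
  apply/esym; rewrite -addrA [X in _ + X]addrC -opprB tailE// /e momentsE//.
  have -> : z ^+ (N - 2 * u.+1) = z ^+ L / z ^+ u.+1.
    rewrite -expfB_cond; last by rewrite (negbTE z0) add0n /L; lia.
    by congr (_ ^+ _); rewrite /L; lia.
  have -> : z ^+ N = z ^+ L * z ^+ u.+1 by rewrite -exprD /L subnK//; lia.
  have -> : (map_poly phi (W * 'X)).[z^-1] =
     ((map_poly phi G).[z^-1] * (map_poly phi H).[z^-1] - 1) * z ^+ L.
    rewrite -hornerM -rmorphM GH1 rmorphD rmorph1 hornerD hornerC addrC addKr.
    rewrite !rmorphM/= !hornerM map_polyX map_polyXn hornerX hornerXn exprS.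
    by rewrite exprVn -!mulrA mulVf ?mulr1 ?expf_neq0.
  by field; rewrite fz !expf_neq0.
rewrite [X in _ --> X](_ : _ = - (phi (c u) / - phi (c u)) *
   (0 * (map_poly phi H).[0] - (map_poly phi (W * 'X)).[0])); last first.
  by rewrite rmorphM/= map_polyX hornerMX mulr0 mul0r subr0 mulr0.
apply: cvgM; last first.
  apply: cvgB; last exact: cvg_horner_inv.
  by apply: cvgM => //; exact: cvg_horner_inv.
apply: cvgN; apply: cvgM; first exact: cvg_cst.
apply: cvgV; last exact: expansion_lead.
by rewrite oppr_eq0 fmorph_eq0.
Qed.

End Step.
End Asymptotics.

(** * Continued fractions and linear fractional transformations *)

Section ContinuedFractions.
Variable K : fieldType.
Implicit Types (a b : nat -> K) (t : K).

Lemma cfrac_shift a b a' b' t k N :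
  (forall i, a i.+1 = a' i) -> (forall i, b i.+1 = b' i) ->
  cfrac a b t k.+1 N = cfrac a' b' t k N.
Proof. by move=> aE bE; elim: N k => //= N IHN k; rewrite IHN aE bE. Qed.

Lemma cfrac_defined_shift a b a' b' t k N :
  (forall i, a i.+1 = a' i) -> (forall i, b i.+1 = b' i) ->
  cfrac_defined a b t k.+1 N = cfrac_defined a' b' t k N.
Proof.
move=> aE bE; elim: N k => //= N IHN k.
by rewrite IHN aE (cfrac_shift _ _ _ aE bE).
Qed.

Lemma cfrac_rcons a b t k N :
  cfrac a b t k N.+1 = cfrac a b (- (b (k + N)%N / (a (k + N)%N + t))) k N.
Proof.
elim: N k => [|N IHN] k; first by rewrite addn0.
by rewrite [LHS]/= -/(cfrac a b t k.+1 N.+1) IHN addSnnS.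
Qed.

Lemma cfrac_defined_rcons a b t k N : cfrac_defined a b t k N.+1 ->
  a (k + N)%N + t != 0 /\
  cfrac_defined a b (- (b (k + N)%N / (a (k + N)%N + t))) k N.
Proof.
elim: N k => [|N IHN] k; first by rewrite addn0 => -[].
move=> [ak /IHN[]]; rewrite addSnnS => aN dN; split=> //; split=> //.
by rewrite -addSnnS -cfrac_rcons.
Qed.

(** The continued fraction as a linear fractional transformation of its tail,
    with the pairs [(y_(k-1), y_k)] of consecutive terms of the two solutions of
    the three-term recurrence, from the index [-1] on, as coefficients. The last step of the fraction is
    absorbed into the tail by [cfrac_rcons]. *)
Lemma cfrac_lft a b t N (q p : nat -> K * K) :
  q 0%N = (-1, 0) -> p 0%N = (0, 1) ->
  (forall k, q k.+1 = ((q k).2, a k * (q k).2 - b k * (q k).1)) ->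
  (forall k, p k.+1 = ((p k).2, a k * (p k).2 - b k * (p k).1)) ->
  cfrac_defined a b t 0 N ->
  (p N).1 * t + (p N).2 != 0 /\
  cfrac a b t 0 N = - (((q N).1 * t + (q N).2) / ((p N).1 * t + (p N).2)).
Proof.
move=> q0 p0 qS pS; elim: N t => [|N IHN] t.
  by rewrite q0 p0 /= mul0r add0r oner_eq0 divr1 addr0 mulN1r opprK.
move=> /cfrac_defined_rcons[aN /IHN[]]; rewrite cfrac_rcons => den0 ->.
have lftE (y : K * K) : y.1 * - (b (0 + N)%N / (a (0 + N)%N + t)) + y.2 =
    (y.2 * t + (a N * y.2 - b N * y.1)) / (a N + t).
  by rewrite add0n in aN *; field.
rewrite !lftE !qS !pS /= in den0 *.
move: den0; rewrite mulf_eq0 negb_or => /andP[-> _]; split=> //.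
by rewrite invf_div mulrA divfK.
Qed.

End ContinuedFractions.

(** * Behaviour at infinity in Stolz domains *)

Section StolzDomains.
Variable R : realType.
Implicit Types (theta : R).

Lemma stolz_infty_neq0 theta : \forall z \near stolz_infty theta, z != 0.
Proof.
exists 0 => // z /= z0 _; apply: contraTneq z0 => ->.
by rewrite normr0 ltxx.
Qed.

Lemma stolz_infty_inv theta : vanishes (stolz_infty theta) (fun z : R[i] => z^-1).
Proof.
apply/cvgr0Pnorm_lt => e e0; exists (complex.Re e)^-1 => // z /= ez _.
have eE : (complex.Re e)^-1%:C = e^-1 by rewrite fmorphV/= RRe_real// gtr0_real.
move: ez; rewrite eE normfV => ez.
by rewrite invf_plt// posrE (lt_trans _ ez)// invr_gt0.
Qed.

Lemma stolz_infty_upper theta :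
  \forall z \near stolz_infty theta, upper_half_plane z.
Proof.
have FF : Filter (@complex_infty R) by exact: complex_infty_filter.
by apply: filterS (withinT (stolz theta) FF) => z [].
Qed.

End StolzDomains.

(** * The parameter of the representation *)

Section AtomsFractionParameter.
Variable R : realType.

(** A function with the expansion of [c] up to order [2 * m], where [m] is normal
    or zero, is the continued fraction of the atoms of [c] at some [tau] which is
    [o(1)]. One [tau] serves all the Stolz domains, because each step defines the
    next function pointwise. *)
Lemma atoms_cfrac_parameter (m : nat) (c : nat -> R) (f : R[i] -> R[i]) :
  hankel_det c m != 0 ->
  (forall theta, 0 < theta <= pi / 2 ->
    moment_expansion (real_complex R) (stolz_infty theta) c (2 * m) f) ->
  exists tau : R[i] -> R[i], forall theta, 0 < theta <= pi / 2 ->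
    vanishes (stolz_infty theta) tau /\
    \forall z \near stolz_infty theta,
      atoms_cfrac_defined c m z (tau z) /\ f z = atoms_cfrac c m z (tau z).
Proof.
elim/ltn_ind: m c f => -[|m] IHm c f Dm f_exp.
  exists f => theta /f_exp fe; split; last by apply: nearW => z; split.
  move: fe; rewrite /moment_expansion muln0.
  by under eq_fun do rewrite big_ord0 addr0 expr0 mulr1.
have [u [um c0 cu Dnext niE]] := normal_indices_cons (ltn0Sn m) Dm.
have nuE := nu_first niE.
have uN : (2 * u.+1 <= 2 * m.+1)%N by rewrite leq_pmul2l.
(* f = - c_u / (a0 + g), and the induction hypothesis applies to g. *)
pose a0 z := cval (atom_a c m.+1 0) z.
have b0E : atom_b c m.+1 0 = c u by rewrite /atom_b nuE.
pose g z := - ((c u)%:C / f z) - a0 z.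
have [||tau tauP] := IHm (m.+1 - u.+1)%N _ (next_seq u.+1 c) g Dnext.
- by rewrite subSS ltnS leq_subr.
- move=> theta /f_exp fe; rewrite mulnBr.
  have -> : g = fun z => - ((c u)%:C / f z) - (c u)%:C *
      \sum_(j < u.+2) (recip (fun j => c (u + j)%N) j)%:C * z ^+ (u.+1 - j).
    apply/funext => z; rewrite /g /a0; congr (_ - _).
    rewrite /cval (atom_a0E nuE c0 cu) map_polyZ hornerZ rmorph_sum horner_sum.
    congr (_ * _); apply: eq_bigr => j _.
    by rewrite /= map_polyZ map_polyXn hornerZ hornerXn.
  exact: (expansion_next (stolz_infty_neq0 theta) (stolz_infty_inv theta) c0 cu uN fe).
exists tau => theta theta_bnd; have [tau0 gE] := tauP _ theta_bnd; split=> //.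
have f_neq0 := expansion_neq0 (stolz_infty_neq0 theta) (stolz_infty_inv theta)
  c0 cu uN (f_exp _ theta_bnd).
apply: filterS2 (f_neq0 (stolz_infty_filter theta)) gE => z fz [gdef gzE].
rewrite /atoms_cfrac_defined /atoms_cfrac (n_normal_shift niE)/=.
have aS k : cval (atom_a c m.+1 k.+1) z =
    cval (atom_a (next_seq u.+1 c) (m.+1 - u.+1) k) z.
  by rewrite (atom_a_shift erefl niE).
have bS k : (atom_b c m.+1 k.+1)%:C =
    (atom_b (next_seq u.+1 c) (m.+1 - u.+1) k)%:C.
  by rewrite (atom_b_shift erefl niE).
rewrite (cfrac_shift _ _ _ aS bS) (cfrac_defined_shift _ _ _ aS bS).
rewrite -/(atoms_cfrac _ _ z (tau z)) -gzE b0E -/(a0 z) /g addrC subrK.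
have cuC : (c u)%:C != 0 :> R[i] by rewrite fmorph_eq0.
split; first by split=> //; rewrite oppr_eq0 mulf_neq0// invr_neq0.
by rewrite invrN mulrN opprK invf_div mulrC divfK.
Qed.

Lemma atoms_cfrac_lft (c : nat -> R) (m : nat) (z t : R[i]) :
  (0 < n_normal c m)%N -> atoms_cfrac_defined c m z t ->
  lft_den c m z t != 0 /\
  atoms_cfrac c m z t = - (lft_num c m z t / lft_den c m z t).
Proof.
move=> N0.
pose ev y k : R[i] * R[i] :=
  (cval (three_term c m y k).1 z, cval (three_term c m y k).2 z).
have evS y k : ev y k.+1 = ((ev y k).2,
    cval (atom_a c m k) z * (ev y k).2 - (atom_b c m k)%:C * (ev y k).1).
  rewrite /ev /=; case: (three_term c m y k) => v w /=; congr (_, _).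
  move: (atom_a c m k) (atom_b c m k) => a b.
  by rewrite /cval rmorphB rmorphM/= map_polyZ hornerD hornerN hornerM hornerZ.
have cval0 : cval 0 z = 0 :> R[i] by rewrite /cval rmorph0 horner0.
have cval1 : cval 1 z = 1 :> R[i] by rewrite /cval rmorph1 hornerC.
move=> /(cfrac_lft (q := ev (-1, 0)) (p := ev (0, 1))) []//.
- by rewrite /ev /= cval0 /cval rmorphN1 hornerN hornerC.
- by rewrite /ev /= cval0 cval1.
(* The pair at n_normal c m has the term of index (n_normal c m).-1 in first
   position only because n_normal c m is positive. *)
have pred y : (three_term c m y (n_normal c m)).1 =
    (three_term c m y (n_normal c m).-1).2.
  by rewrite -{1}(prednK N0)/=; case: (three_term _ _ _ _).
by rewrite /ev /= !pred.
Qed.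

End AtomsFractionParameter.

Theorem theorem3p1 (R : realType) (n m : nat) (hn : (2 <= n)%N) (hm : (1 <= m)%N)
  (s : 'I_(2 * m - 1).+1 -> {ffun 'I_n.-1 -> 'I_(2 * m - 1).+1} -> R)
  (hnormal : forall J : {ffun 'I_n.-1 -> 'I_(2 * m - 1).+1},
      m \in normal_indices (associated_seq s J) m)
  (F : R[i] -> ('I_n.-1 -> R[i]) -> R[i])
  (hF : MP_solution s F) :
  exists tau : {ffun 'I_n.-1 -> 'I_(2 * m - 1).+1} -> R[i] -> R[i],
    [/\ forall J, stolz_littleo (tau J) (fun=> 1),
        stolz_near (fun z1 =>
          (forall J, atoms_cfrac_defined (associated_seq s J) m z1 (tau J z1)) /\
          forall z : 'I_n.-1 -> R[i], (forall t, z t != 0) ->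
            F z1 z =
              \sum_J (tail_monomial z J)^-1 *
                     atoms_cfrac (associated_seq s J) m z1 (tau J z1))
      & stolz_near (fun z1 =>
          (forall J, lft_den (associated_seq s J) m z1 (tau J z1) != 0) /\
          forall z : 'I_n.-1 -> R[i], (forall t, z t != 0) ->
            F z1 z =
              - \sum_J (tail_monomial z J)^-1 *
                       (lft_num (associated_seq s J) m z1 (tau J z1) /
                        lft_den (associated_seq s J) m z1 (tau J z1)))].
Proof.
case: hF => FJ [FJ_exp FE].
set c := associated_seq s in hnormal *.
have lE : (2 * m - 1).+1 = (2 * m)%N by rewrite subn1 prednK// muln_gt0.
have N0 J : (0 < n_normal (c J) m)%N.
  by move: (hnormal J); rewrite /n_normal; case: normal_indices.
have /boolp.choice[tau0 tau0P] : forall J, exists tau : R[i] -> R[i],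
    forall theta, 0 < theta <= pi / 2 -> vanishes (stolz_infty theta) tau /\
    \forall z \near stolz_infty theta, atoms_cfrac_defined (c J) m z (tau z) /\
      FJ J z = atoms_cfrac (c J) m z (tau z).
  move=> J; apply: atoms_cfrac_parameter.
    by move: (hnormal J); rewrite mem_filter => /andP[].
  move=> theta theta_bnd; move: (FJ_exp J theta theta_bnd) => /=.
  rewrite eqo_vanishes; last first.
    by apply: filterS (stolz_infty_neq0 theta) => z z0; rewrite invr_neq0// expf_neq0.
  by under eq_fun do rewrite invrK; rewrite lE.
have repr : stolz_near (fun z1 => (forall J, atoms_cfrac_defined (c J) m z1 (tau0 J z1)) /\
    forall z : 'I_n.-1 -> R[i], (forall t, z t != 0) -> F z1 z =
      \sum_J (tail_monomial z J)^-1 * atoms_cfrac (c J) m z1 (tau0 J z1)).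
  move=> theta theta_bnd.
  have /filter_forall near_all : forall J, \forall z \near stolz_infty theta,
      atoms_cfrac_defined (c J) m z (tau0 J z) /\
      FJ J z = atoms_cfrac (c J) m z (tau0 J z).
    by move=> J; case: (tau0P J _ theta_bnd).
  apply: filterS2 (stolz_infty_upper theta) near_all => z1 z1_up FJE.
  split=> [J|z z0]; first by case: (FJE J).
  rewrite FE//; apply: eq_bigr => J _; rewrite mulrC.
  by case: (FJE J) => _ <-.
exists tau0; split=> //.
- move=> J theta theta_bnd; apply/eqo_vanishes.
    by apply: nearW => z; rewrite oner_eq0.
  by under eq_fun do rewrite divr1; case: (tau0P J _ theta_bnd).
- move=> theta /repr; apply: filterS => z1 [def_z1 Fz1]; split=> [J|z z0].
    by case: (atoms_cfrac_lft (N0 J) (def_z1 J)).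
  rewrite Fz1// -sumrN; apply: eq_bigr => J _.
  by case: (atoms_cfrac_lft (N0 J) (def_z1 J)) => _ ->; rewrite mulrN.
Qed.
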